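(* For every integer $d\ge 1$, $$P_d=\sum_{\delta\in \mathrm{PCom}^*_{\mathrm{dyad}}(d)} (-1)^{\ell(\delta)-1} L(\delta)\, E_\delta^+.$$
   Context: A composition of $n\ge 0$ is a finite tuple of positive integers with sum $n$; its length $\ell$ is the number of entries. A polycomposition of $n$ is a sequence $\delta=(\alpha^{(1)},\alpha^{(2)},\dots)$ of (possibly empty) compositions with $\sum_{i\ge1} i|\alpha^{(i)}|=n$, where $|\alpha|$ is the sum of the entries of $\alpha$; write $\delta|^i=\alpha^{(i)}$ and $\ell(\delta)=\sum_i\ell(\delta|^i)$. Each part $d$ of $\delta|^r$ gives a block $d^r$ of $\delta$ (degree $d$, multiplicity $r$; not exponentiation). $\mathrm{PCom}^*_{\mathrm{dyad}}(d)$ is the set of singular dyadic polycompositions of $d$: those having exactly one multiplicity, which must be a power of $2$; i.e. $\delta=(d_1,\dots,d_k)^{r}$ with $r=2^m$, $m\ge0$, $k\ge1$, $d_i\ge 1$ and $r(d_1+\cdots+d_k)=d$. For such $\delta$, $\ell(\delta)=k$ and $L(\delta)=r\,d_k$. Let $x_{i,j}$ ($i,j\ge 1$) be indeterminates with $\deg x_{i,j}=i$; all series have rational coefficients. A monomial is square-free if every exponent is at most $1$. $E^+_d$ is the sum of all square-free monomials of degree $d$, and for $d\ge1$, $P_d=\sum_{k\mid d}\sum_{j\ge1} k\,x_{k,j}^{d/k}$, with $k$ ranging over positive divisors of $d$. For a block $d^r$, $E^+_{d^r}$ is obtained from $E^+_d$ by replacing each $x_{i,j}$ by $x_{i,j}^r$,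 and $E^+_\delta=\prod E^+_{d^r}$ over all blocks $d^r$ of $\delta$ (counted with repetition). *)

(* Defs.v *)
From HB Require Import structures.
From mathcomp Require Export all_boot all_order all_algebra.
From mathcomp Require Export finmap.
From mathcomp Require Export boolp classical_sets fsbigop.
From mathcomp Require Export monalg.

Set Implicit Arguments.
Unset Strict Implicit.
Unset Printing Implicit Defensive.

Import GRing.Theory Num.Theory.

Local Open Scope classical_set_scope.
Local Open Scope ring_scope.

Record posnat := PosNat { posnat_val :> nat; _ : (0 < posnat_val)%N }.

HB.instance Definition _ := [isSub for posnat_val].
HB.instance Definition _ := [Countable of posnat by <:].

(* The pair (i, j) stands for the indeterminate x_{i,j}. *)
Definition var : choiceType := (posnat * posnat)%type.

Definition mon : choiceType := {cmonom var}.

Definition mon_deg (m : mon) : nat := (\sum_(v <- finsupp m) v.1 * m v)%N.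

Definition squarefree (m : mon) : Prop := forall v : var, (m v <= 1)%N.

(* A formal power series in the x_{i,j} is identified with its family of
   coefficients. *)
Definition fps : Type := mon -> rat.

Definition fps_mon (m : mon) : fps := fun m' => (m' == m)%:R.

Definition fps_scale (c : rat) (f : fps) : fps := fun m => c * f m.

Definition fps_mul (f g : fps) : fps :=
  fun m => \sum_(p \in [set p : mon * mon | mmul p.1 p.2 = m]) f p.1 * g p.2.

(* Possibly infinite sums of series are taken coefficientwise. They are only
   meant for families in which every monomial occurs in finitely many members:
   \sum_(i \in A) returns 0 on a family with infinite support. *)
Definition fps_sum (I : choiceType) (A : set I) (F : I -> fps) : fps :=
  fun m => \sum_(i \in A) F i m.

(* Replacing every x_{i,j} by x_{i,j}^r sends a monomial m to m^r; only used
   for 0 < r. *)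
Definition fps_subst_pow (r : nat) (f : fps) : fps :=
  fps_sum [set: mon] (fun m => fps_scale (f m) (fps_mon (expcmn m r))).

Definition Eplus (d : nat) : fps :=
  fps_sum [set m : mon | squarefree m /\ mon_deg m = d] fps_mon.

Definition Eplus_block (d r : posnat) : fps := fps_subst_pow r (Eplus d).

Definition Pser (d : nat) : fps :=
  fps_sum [set k : posnat | (k %| d)%N] (fun k =>
    fps_sum [set: posnat] (fun j =>
      fps_scale k%:R (fps_mon (expcmn (ucm (k, j)) (d %/ k))))).

Definition composition : choiceType := seq posnat.

Definition comp_size (a : composition) : nat := (\sum_(d <- a) d)%N.

(* delta i is the composition attached to the multiplicity i. Having finite
   support is no restriction, as a polycomposition of n has only finitely many
   nonempty compositions; [finsupp delta] is the set of its multiplicities. *)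
Definition polycomp : choiceType := {fsfun posnat -> composition with [::]}.

Definition polycomp_size (delta : polycomp) : nat :=
  (\sum_(i <- finsupp delta) i * comp_size (delta i))%N.

Definition polycomp_length (delta : polycomp) : nat :=
  (\sum_(i <- finsupp delta) size (delta i))%N.

(* The pair (d, r) stands for the block d^r. *)
Definition blocks (delta : polycomp) : seq (posnat * posnat) :=
  [seq (d, r) | r <- finsupp delta, d <- delta r].

Definition Eplus_polycomp (delta : polycomp) : fps :=
  \big[fps_mul/fps_mon mone]_(b <- blocks delta) Eplus_block b.1 b.2.

Definition PCom (n : nat) : set polycomp :=
  [set delta | polycomp_size delta = n].

Definition PCom_dyad (n : nat) : set polycomp :=
  [set delta | PCom n delta /\
    exists (r : posnat) (m : nat),
      finsupp delta = [fset r]%fset /\ r = (2 ^ m)%N :> nat].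

(* On a singular delta = (d_1, ..., d_k)^r the sum has the single term
   r * d_k. *)
Definition polycomp_L (delta : polycomp) : nat :=
  (\sum_(r <- finsupp delta) r * last 0 (map posnat_val (delta r)))%N.

(* Main.v *)
Require Import Defs.
From mathcomp Require Import functions cardinality zify ring.

(* For fixed r, summing (-1)^(k-1) r d_k E_(d_1^r) ... E_(d_k^r) u^(r(d_1+...+d_k))
   over all compositions gives u F'(u)/F(u) with F(u) = prod (1 + x_(i,j)^r u^(ir)),
   that is, sum over (i,j) and N >= 1 of (-1)^(N-1) r i (x_(i,j) u^i)^(rN). Its
   degree-d part is verified coefficientwise by induction on d, peeling off d_1:
   this amounts to F * (u F'/F) = u F'. Finally, for n >= 1,
   sum over r = 2^a dividing n of r (-1)^(n/r-1) equals 1, so each x_(i,j)^n is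
   left with coefficient i. *)

Import Order.TTheory GRing.Theory Num.Theory.

Local Open Scope classical_set_scope.
Local Open Scope ring_scope.

(** * Monomials: exponents, degrees and factorizations *)

Lemma posnat_gt0 (d : posnat) : (0 < d)%N.
Proof. by case: d. Qed.

Lemma fsum_single (I : choiceType) (A : set I) (i0 : I) (F : I -> rat) :
  (forall i, A i -> i != i0 -> F i = 0) ->
  \sum_(i \in A) F i = if i0 \in A then F i0 else 0.
Proof.
move=> F0; rewrite fsbig_mkcond (fsbigTE [fset i0]%fset) ?big_seq_fset1 // => i.
by rewrite in_fset1 /patch; case: ifP => // /set_mem Ai /F0 ->.
Qed.

Lemma mmulE (m n : mon) v : mmul m n v = (m v + n v)%N.
Proof. exact: cmM. Qed.

Lemma expcmnE (m : mon) r v : expcmn m r v = (r * m v)%N.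
Proof.
rewrite /expcmn; case: r => [|r]; first by rewrite mul0n onecmE.
by rewrite iteropS; elim: r => [|r IHr] /=; rewrite ?mul1n // mulcmE IHr.
Qed.

Lemma mon_ext (m n : mon) : (forall v, m v = n v) -> m = n.
Proof. by move=> mn; apply/eqP/cmP. Qed.

Lemma mon_degE (m : mon) (A : {fset var}) : (finsupp m `<=` A)%fset ->
  mon_deg m = (\sum_(v <- A) v.1 * m v)%N.
Proof.
move=> mA; rewrite /mon_deg; apply: big_fset_incl => // v _.
by rewrite memNfinsupp => /eqP ->; rewrite muln0.
Qed.

Lemma mon_degM (m n : mon) : mon_deg (mmul m n) = (mon_deg m + mon_deg n)%N.
Proof.
rewrite (mon_degE _ (finsupp m `|` finsupp n)%fset) ?mdomD //.
rewrite (mon_degE m (finsupp m `|` finsupp n)%fset) ?fsubsetUl //.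
rewrite (mon_degE n (finsupp m `|` finsupp n)%fset) ?fsubsetUr //.
by rewrite -big_split; apply: eq_bigr => v _; rewrite mmulE mulnDr.
Qed.

Lemma finsupp_expcmn (m : mon) r : (0 < r)%N ->
  finsupp (expcmn m r) = finsupp m :> {fset var}.
Proof.
move=> r0; apply/fsetP => v.
by rewrite -!cmE_neq0 expcmnE muln_eq0 eqn0Ngt r0.
Qed.

Lemma mon_degX (m : mon) r : (0 < r)%N -> mon_deg (expcmn m r) = (r * mon_deg m)%N.
Proof.
move=> r0; rewrite /mon_deg finsupp_expcmn // big_distrr /=.
by apply: eq_bigr => v _; rewrite expcmnE mulnCA.
Qed.

(** The first factor is bounded exponentwise by [m], hence coded by a function from the support of
    [m] to a bounded range of exponents, and the second factor is then the quotient. *)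
Lemma finite_factor (m : mon) : finite_set [set p : mon * mon | mmul p.1 p.2 = m].
Proof.
pose B := (\max_(w : finsupp m) m (val w)).+1.
pose g (f : {ffun finsupp m -> 'I_B}) : mon :=
  mkcmonom [fsfun v : finsupp m => (f v : nat) | 0%N].
apply: (@sub_finite_set _ _ ((fun f => (g f, divcm m (g f))) @` setT)); last first.
  exact/finite_image/finite_finset.
move=> [s u] /= su; have sm v : (s v <= m v)%N by rewrite -su mmulE leq_addr.
pose f : {ffun finsupp m -> 'I_B} := [ffun v => inord (s (val v))].
have gs : g f = s.
  apply: mon_ext => v; rewrite /g cmE /= fsfun_ffun.
  case: insubP => [w vm wv|] /=.
    rewrite ffunE inordK ?wv // ltnS -wv.
    by apply: leq_trans (sm _) _; apply: leq_bigmax w.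
  by rewrite -cmE_neq0 negbK => /eqP mv0; have := sm v; rewrite mv0 leqn0 => /eqP.
exists f => //; rewrite gs; congr pair; apply: mon_ext => v.
by rewrite divcmE -su mmulE addKn.
Qed.

Definition factor (m : mon) : {fset mon * mon} :=
  fset_set [set p : mon * mon | mmul p.1 p.2 = m].

Lemma in_factor (m : mon) p : (p \in factor m) = (mmul p.1 p.2 == m).
Proof.
rewrite in_fset_set; last exact: finite_factor.
by apply/idP/eqP => [/set_mem|?]; last exact/mem_set.
Qed.

Lemma fps_mulE f g m : fps_mul f g m = \sum_(p <- factor m) f p.1 * g p.2.
Proof. by rewrite /fps_mul fsbig_finite //; apply: finite_factor. Qed.

(** * Coefficients of the square-free series and their blocks *)

(* Characterizes the r-th powers of the square-free monomials when 0 < r. *)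
Definition powsqf (r : nat) (m : mon) := all (fun v => m v == r) (finsupp m).

Lemma powsqfP r (m : mon) : reflect (forall v, m v = 0%N \/ m v = r) (powsqf r m).
Proof.
apply: (iffP allP) => [mr v|mr v]; last first.
  by rewrite -cmE_neq0; case: (mr v) => ->; rewrite ?eqxx.
by case: (mdomP m v) => [/mr/eqP|_]; [right|left].
Qed.

Lemma EplusE d m : Eplus d m = (powsqf 1 m && (mon_deg m == d))%:R.
Proof.
rewrite /Eplus /fps_sum /fps_mon (fsum_single _ _ m); last first.
  by move=> i _; rewrite eq_sym => /negPf ->.
rewrite eqxx; case: ifPn => [/set_mem [sm ->]|/negP Nm].
  suff -> : powsqf 1 m by rewrite eqxx.
  by apply/powsqfP => v; have := sm v; case: (m v) => [|[|]]; auto.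
case: andP => //= -[/powsqfP sm /eqP dm]; case: Nm; apply: mem_set; split=> // v.
by case: (sm v) => ->.
Qed.

Lemma Eplus_blockE (d r : posnat) m :
  Eplus_block d r m = (powsqf r m && (mon_deg m == r * d)%N)%:R.
Proof.
have r0 := posnat_gt0 r.
rewrite /Eplus_block /fps_subst_pow /fps_sum /fps_scale /fps_mon.
(* The only monomial whose [r]-th power can be [m]. *)
pose n : mon := mkcmonom [fsfun v in finsupp m => (m v %/ r)%N | 0%N].
have nE v : n v = (m v %/ r)%N.
  by rewrite cmE /= fsfun_fun; case: (mdomP m v); rewrite ?div0n.
move: n nE => n nE.
rewrite (fsum_single _ _ n) ?in_setT; last first.
  move=> i _ iNn; case: eqVneq => [mi|_]; last by rewrite /= mulr0.
  case/eqP: iNn; apply: mon_ext => v; rewrite nE mi expcmnE mulKn //.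
rewrite EplusE; case: (eqVneq m (expcmn n r)) => [mn|mNn].
  rewrite /= mulr1 (_ : mon_deg m = r * mon_deg n)%N; last by rewrite mn mon_degX.
  rewrite eqn_pmul2l //; congr (_ && _)%:R.
  have mnv v : m v = (r * n v)%N by rewrite mn expcmnE.
  apply/powsqfP/powsqfP => H v.
    by rewrite mnv; case: (H v) => ->; rewrite ?muln0 ?muln1; [left|right].
  by case: (H v); rewrite nE => ->; rewrite ?div0n ?divnn ?r0; [left|right].
rewrite /= mulr0; case: powsqfP => //= H; case/eqP: mNn; apply: mon_ext => v.
by rewrite expcmnE nE; case: (H v) => ->; rewrite ?div0n ?muln0 // divnn r0 muln1.
Qed.

(** * Logarithmic derivative of the product of all 1 + x^r *)

Definition varX (v : var) (k : nat) : mon := expcmn (ucm v) k.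

Lemma varXE v k w : varX v k w = (k * (v == w))%N.
Proof. by rewrite expcmnE ucmE. Qed.

Lemma varXv v k : varX v k v = k.
Proof. by rewrite varXE eqxx muln1. Qed.

(* Contribution of the indeterminate v to the coefficient of u in the logarithmic
   derivative of prod (1 + x^r), divided by r. *)
Definition logder_var (r : nat) (v : var) (u : mon) : rat :=
  if [&& u == varX v (u v), (0 < u v)%N & (r %| u v)%N]
  then (-1) ^+ (u v %/ r).-1 * v.1%:R else 0.

Lemma logder_varX r v j : (0 < r)%N -> logder_var r v (varX v (r * j.+1)) = (-1) ^+ j * v.1%:R.
Proof.
by move=> r0; rewrite /logder_var varXv eqxx dvdn_mulr // muln_gt0 r0 /= mulKn.
Qed.

(** Dividing by a power of [v] changes the exponent at [v] only. Hence two values of [k] that both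
    leave exponent 0 or [r] at [v] give the same answer, which drives the cancellation below. *)
Lemma powsqf_divX r v (m : mon) k : powsqf r (divcm m (varX v k)) =
  ((m v - k)%N \in [:: 0%N; r]) && all (fun w => (w == v) || (m w == r)) (finsupp m).
Proof.
apply/powsqfP/andP => [H|[mvk /allP H] w].
  split; first by have := H v; rewrite divcmE varXv !inE; case=> ->; rewrite eqxx ?orbT.
  apply/allP => w; rewrite -cmE_neq0; case: (eqVneq w v) => //= wv.
  by case: (H w); rewrite divcmE varXE [v == w]eq_sym (negPf wv) muln0 subn0 => ->; rewrite eqxx.
rewrite divcmE varXE eq_sym; case: eqVneq => [->|wv].
  by rewrite muln1; move: mvk; rewrite !inE => /orP [] /eqP; auto.
rewrite muln0 subn0; case: (mdomP m w) => [/H|_]; last by left.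
by rewrite (negPf wv) /= => /eqP; right.
Qed.

Lemma divX0 v m : divcm m (varX v 0) = m.
Proof. by apply: mon_ext => w; rewrite divcmE varXE mul0n subn0. Qed.

(* When m has exponent r * q at v, only the powers r * q and r * (q - 1) of v can be
   split off as p.2; their contributions cancel unless q = 1. *)
Lemma sum_factor_logder_var r v (m : mon) : (0 < r)%N -> v \in finsupp m ->
  \sum_(p <- factor m) (powsqf r p.1)%:R * logder_var r v p.2 = (powsqf r m)%:R * v.1%:R.
Proof.
move=> r0; rewrite -cmE_neq0 -lt0n => mv0.
pose pr k := (divcm m (varX v k), varX v k).
have pr_factor k : (k <= m v)%N -> pr k \in factor m.
  move=> km; rewrite in_factor; apply/eqP/mon_ext => w.
  rewrite mmulE /= divcmE varXE.
  by case: eqVneq => [<-|_]; rewrite /= ?muln1 ?muln0 ?subnK ?subn0 ?addn0.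
(* A nonzero term has [p.2] equal to the power [r * j] of [v]. The alternative for [m v] records
   whether [p.1] has exponent 0 or [r] at [v]. *)
have F0 p : p \in factor m -> powsqf r p.1 -> logder_var r v p.2 != 0 ->
    exists j, [/\ m v = r * j \/ m v = r * j.+1, (0 < j)%N & p = pr (r * j)]%N.
  case: p => s u; rewrite in_factor => /eqP /= su /powsqfP sr.
  rewrite /logder_var; case: ifP => [/and3P [/eqP uX u0 /dvdnP [j uj]] _|]; last by rewrite eqxx.
  exists j; have mE w : m w = (s w + u w)%N by rewrite -su mmulE.
  split; last 1 first.
  - rewrite mulnC -uj /pr -uX; congr pair; apply: mon_ext => w.
    by rewrite divcmE mE addnK.
  - by have := sr v; rewrite mE uj; lia.
  - by move: u0; rewrite uj; case: (j).
have [/dvdnP [q mq]|Nr] := boolP (r %| m v)%N; last first.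
  rewrite big1_seq => [|p /andP [_ pm]]; last first.
    case: (boolP (powsqf r p.1)) => [sr|]; last by rewrite mul0r.
    have [->|/(F0 p pm sr) [j [mj _ _]]] := eqVneq (logder_var r v p.2) 0; first by rewrite mulr0.
    by case/negP: Nr; case: mj => ->; apply: dvdn_mulr.
  case: powsqfP => [H|_]; last by rewrite mul0r.
  by case/negP: Nr; case: (H v) => ->; rewrite ?dvdn0 ?dvdnn.
have {}mq : m v = (r * q.-1.+1)%N by case: q mq mv0 => [|q] ->; [rewrite mul0n|rewrite mulnC].
(* From here [q] is one less than the quotient of [m v] by [r]. In the case 0, the exponent is
   exactly [r] and only the term splitting off all of it survives. *)
case: {q}(q.-1) mq => [|q] mq.
  rewrite (bigD1_seq (pr (m v))) ?fset_uniq ?pr_factor //=.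
  rewrite big1_seq ?addr0 => [|p /andP [pN pm]]; last first.
    case: (boolP (powsqf r p.1)) => [sr|]; last by rewrite mul0r.
    have [->|/(F0 p pm sr) [j [mj j0 pj]]] := eqVneq (logder_var r v p.2) 0; first by rewrite mulr0.
    case: mj => mj; first by case/eqP: pN; rewrite pj -mj.
    by move/eqP: mj; rewrite mq eqn_pmul2l // eqSS eq_sym eqn0Ngt j0.
  rewrite {2}mq logder_varX // mul1r; congr (_%:R * _); congr nat_of_bool.
  by rewrite -[in RHS](divX0 v m) !powsqf_divX subn0 subnn !inE mq muln1 !eqxx orbT.
have -> : powsqf r m = false.
  apply/powsqfP => /(_ v); rewrite mq; case=> /eqP; rewrite ?muln_eq0 ?(eqn0Ngt r) ?r0 //.
  by rewrite -[X in _ == X]muln1 eqn_pmul2l.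
rewrite mul0r (big_rem (pr (m v))) ?pr_factor //= (big_rem (pr (r * q.+1)%N)) /=; last first.
  rewrite mem_rem_uniq ?fset_uniq // !inE pr_factor ?mq ?leq_mul // andbT.
  apply/eqP => /(congr1 snd) /(congr1 (fun u : mon => u v)) /=; rewrite !varXv.
  by move/eqP; rewrite eqn_pmul2l // eqn_leq ltnn andbF.
rewrite [X in _ + (_ + X)]big1_seq => [|p]; last first.
  rewrite /= mem_rem_uniq ?rem_uniq ?fset_uniq // inE /= mem_rem_uniq ?fset_uniq // inE /=.
  case/and3P => pN2 pN1 pm.
  case: (boolP (powsqf r p.1)) => [sr|]; last by rewrite mul0r.
  have [->|/(F0 p pm sr) [j [mj j0 pj]]] := eqVneq (logder_var r v p.2) 0; first by rewrite mulr0.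
  case: mj => mj; first by case/eqP: pN1; rewrite pj -mj.
  move/eqP: mj; rewrite mq eqn_pmul2l // eqSS => /eqP qj.
  by case/eqP: pN2; rewrite pj qj.
rewrite mq !logder_varX // addr0 exprS.
(* The exponents left at [v] are 0 and [r], both admissible, so the two indicators agree and the
   opposite signs cancel. *)
have -> : powsqf r (divcm m (varX v (r * q.+2))) = powsqf r (divcm m (varX v (r * q.+1))).
  by rewrite !powsqf_divX mq subnn -mulnBr subSS subSnn muln1 !inE !eqxx orbT.
by ring.
Qed.

Definition logder (r : nat) (u : mon) : rat := \sum_(v <- finsupp u) logder_var r v u.

Lemma logderE r (u : mon) (A : {fset var}) : (finsupp u `<=` A)%fset ->
  logder r u = \sum_(v <- A) logder_var r v u.
Proof.
move=> uA; apply: big_fset_incl => // v _; rewrite memNfinsupp /logder_var => /eqP ->.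
by rewrite ltnn andbF.
Qed.

(** This is F * (u F'/F) = u F' divided by [r] and read at the monomial [m]: a monomial of F is a
    product of distinct x_v^r, and u d/du multiplies it by its degree, [r] times the sum of the
    [v.1]. *)
Lemma sum_factor_logder r (m : mon) : (0 < r)%N ->
  \sum_(p <- factor m) (powsqf r p.1)%:R * logder r p.2 =
  (powsqf r m)%:R * (\sum_(v <- finsupp m) v.1)%:R :> rat.
Proof.
move=> r0; rewrite natr_sum big_distrr /=.
transitivity (\sum_(p <- factor m) \sum_(v <- finsupp m) (powsqf r p.1)%:R * logder_var r v p.2).
  apply: eq_big_seq => p; rewrite in_factor => /eqP pm; rewrite -big_distrr /=.
  by rewrite (logderE _ _ (finsupp m)) // -pm mdomD fsubsetUr.
by rewrite exchange_big; apply: eq_big_seq => v vm; apply: sum_factor_logder_var.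
Qed.

Lemma mon_deg_eq0 (m : mon) : (mon_deg m == 0%N) = (m == mone).
Proof.
apply/eqP/eqP => [m0|->]; last by rewrite /mon_deg mdom1 big_seq_fset0.
apply: mon_ext => v; rewrite cm1; case: (mdomP m v) => // vm.
move: m0; rewrite /mon_deg (bigD1_seq v) ?fset_uniq //= => /eqP.
rewrite addn_eq0 muln_eq0 => /andP [/orP [v0|/eqP //] _].
by move: v0; rewrite eqn0Ngt posnat_gt0.
Qed.

Lemma mon_deg_powsqf r (m : mon) : powsqf r m ->
  mon_deg m = (r * \sum_(v <- finsupp m) v.1)%N.
Proof.
move=> /allP sm; rewrite big_distrr /mon_deg /=.
by apply: eq_big_seq => v /sm /eqP ->; rewrite mulnC.
Qed.

(** * Enumeration of compositions *)

Definition parts_upto (n : nat) : seq posnat := pmap insub (iota 1 n).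

Lemma mem_parts_upto n (d : posnat) : (d \in parts_upto n) = (d <= n)%N.
Proof.
by rewrite mem_pmap_sub /= mem_iota add1n ltnS posnat_gt0.
Qed.

Lemma uniq_parts_upto n : uniq (parts_upto n).
Proof. by apply: pmap_sub_uniq; apply: iota_uniq. Qed.

(* f is fuel, sufficient as soon as n <= f. *)
Fixpoint comps (f n : nat) : seq composition :=
  if n == 0%N then [:: [::]] else
  if f is f'.+1 then [seq d :: a | d <- parts_upto n, a <- comps f' (n - posnat_val d)]
  else [::].

Lemma comp_size_cons (d : posnat) (a : composition) :
  comp_size (d :: a) = (d + comp_size a)%N.
Proof. by rewrite /comp_size big_cons. Qed.

Lemma mem_comps f n (a : composition) : (n <= f)%N ->
  (a \in comps f n) = (comp_size a == n).
Proof.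
elim: f n a => [|f IHf] [|n] a nf //=; try
  by rewrite inE; case: a => [|d a]; rewrite ?comp_size_cons /comp_size ?big_nil //
     addn_eq0 eqn0Ngt posnat_gt0.
apply/allpairsPdep/eqP => [[d [b [dn bn ->]]]|].
  rewrite mem_parts_upto in dn; rewrite IHf in bn; last by have := posnat_gt0 d; lia.
  by rewrite comp_size_cons (eqP bn) subnKC.
case: a => [|d a]; first by rewrite /comp_size big_nil.
rewrite comp_size_cons => dan; exists d, a; split=> //.
  by rewrite mem_parts_upto -dan leq_addr.
rewrite IHf; first by rewrite -dan addKn.
by have := posnat_gt0 d; lia.
Qed.

Lemma uniq_comps f n : uniq (comps f n).
Proof.
elim: f n => [|f IHf] [|n] //=.
apply: allpairs_uniq_dep => [|d _|]; rewrite ?uniq_parts_upto //.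
by move=> [d1 a1] [d2 a2] _ _ /= [-> ->].
Qed.

(** * Signed sum over compositions for a fixed multiplicity *)

(** The factor [r] of L is left out and restored in the final sum. The empty composition gets weight
    0 through the default value of [last]. *)
Definition comp_weight (a : composition) : rat :=
  (-1) ^+ (size a - 1) * (last 0%N (map posnat_val a))%:R.

Definition Eplus_comp (r : posnat) (a : composition) : fps :=
  \big[fps_mul/fps_mon mone]_(d <- a) Eplus_block d r.

(** Prepending a part to a nonempty composition flips the sign and keeps the last part. If the tail
    is empty, [d] itself is the last part, and the weight 0 of the tail lets one formula cover both
    cases. *)
Lemma comp_weight_cons (d : posnat) a :
  comp_weight (d :: a) = (a == [::])%:R * d%:R - comp_weight a.
Proof.
rewrite /comp_weight; case: a => [|e a] /=; first by rewrite mulr0 subr0.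
by rewrite !subn1 /= mul0r sub0r exprS mulN1r mulNr.
Qed.

Lemma big_factor_snd1 m (F : mon * mon -> rat) :
  \sum_(p <- factor m) (p.2 == mone)%:R * F p = F (m, mone).
Proof.
rewrite (bigD1_seq (m, mone)) ?fset_uniq ?in_factor /= ?mulm1 //.
rewrite eqxx mul1r big1_seq ?addr0 // => -[s u] /andP [+ +] /=.
rewrite in_factor /=; case: (eqVneq u mone) => [->|_]; last by rewrite /= mul0r.
by rewrite mulm1 => /eqP + /eqP sm; rewrite sm.
Qed.

Lemma big_factor_fst1 m (F : mon * mon -> rat) :
  \sum_(p <- factor m) (p.1 == mone)%:R * F p = F (mone, m).
Proof.
rewrite (bigD1_seq (mone, m)) ?fset_uniq ?in_factor /= ?mul1m //.
rewrite eqxx mul1r big1_seq ?addr0 // => -[s u] /andP [+ +] /=.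
rewrite in_factor /=; case: (eqVneq s mone) => [->|_]; last by rewrite /= mul0r.
by rewrite mul1m => /eqP + /eqP sm; rewrite sm.
Qed.

Definition comp_sum r f n m := \sum_(a <- comps f n) comp_weight a * Eplus_comp r a m.

(** Splitting off the first part [d] turns its block into a convolution factor. By
    [comp_weight_cons] the rest is the negated sum over the tails, plus a boundary term present only
    when the tail is empty, that is, [d = n.+1]. *)
Lemma comp_sum_rec r f n m : (n <= f)%N ->
  comp_sum r f.+1 n.+1 m =
  \sum_(p <- factor m) \sum_(d <- parts_upto n.+1) Eplus_block d r p.1 *
    ((n.+1 - d == 0)%N%:R * (p.2 == mone)%:R * d%:R - comp_sum r f (n.+1 - d) p.2).
Proof.
move=> nf; rewrite /comp_sum /= big_allpairs_dep exchange_big /=.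
apply: eq_big_seq => d dn.
transitivity (\sum_(a <- comps f (n.+1 - d)) \sum_(p <- factor m)
    Eplus_block d r p.1 * (comp_weight (d :: a) * Eplus_comp r a p.2)).
  apply: eq_bigr => a _; rewrite /Eplus_comp big_cons fps_mulE big_distrr /=.
  by apply: eq_bigr => p _; rewrite mulrCA.
rewrite exchange_big; apply: eq_bigr => p _; rewrite -big_distrr; congr (_ * _).
under eq_bigr do rewrite comp_weight_cons mulrBl.
rewrite big_split sumrN /=; congr (_ - _).
have [n0|n0] := eqVneq.
  by rewrite n0; case: (f) => [|f'] /=;
     rewrite big_seq1 /Eplus_comp big_nil /fps_mon eqxx !mul1r mulrC.
rewrite !mul0r big1_seq // => a /=; rewrite mem_comps; last first.
  by move: dn; rewrite mem_parts_upto; have := posnat_gt0 d; lia.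
case: (eqVneq a [::]) => [->|_ _]; last by rewrite /= !mul0r.
by rewrite /comp_size big_nil eq_sym (negPf n0).
Qed.

(** The recursion is the recurrence that F * (u F'/F) = u F' imposes on the coefficients of u F'/F,
    so both sides agree by induction on [f]. *)
Lemma comp_sumE (r : posnat) f n m : (n <= f)%N ->
  comp_sum r f n m = if mon_deg m == (r * n)%N then logder r m else 0.
Proof.
have r0 := posnat_gt0 r.
(* For [n = 0] both sides vanish: the empty composition has weight 0, and [logder] at the monomial 1
   is an empty sum. *)
elim: f n m => [|f IHf] [|n] m nf //; try
  by rewrite /comp_sum /= big_seq1 /comp_weight mulr0 mul0r muln0 mon_deg_eq0;
     case: eqP => // ->; rewrite /logder mdom1 big_seq_fset0.
rewrite comp_sum_rec //; set N := n.+1.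
under eq_bigr => p _.
  under eq_big_seq => d dN.
    rewrite Eplus_blockE IHf; last first.
      by move: dN; rewrite mem_parts_upto; have := posnat_gt0 d; lia.
    over.
  over.
have [mN|mN] := eqVneq; last first.
  rewrite big1_seq // => p /=; rewrite in_factor => /eqP pm.
  rewrite big1_seq // => d /=; rewrite mem_parts_upto => dN.
  have [|_] := eqVneq (mon_deg p.1); last by rewrite andbF /= mul0r.
  move=> p1; case: (eqVneq (mon_deg p.2)) => [p2|_].
    by case/eqP: mN; rewrite -pm mon_degM p1 p2 -mulnDr subnKC.
  have [dN0|_] := eqVneq (N - d)%N 0%N; last by rewrite /= !mul0r subr0 mulr0.
  have [p2|_] := eqVneq p.2; last by rewrite /= !mul0r subr0 mulr0.
  case/eqP: mN; rewrite -pm mon_degM p1 p2 /mon_deg mdom1 big_seq_fset0 addn0.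
  by congr (_ * _)%N; lia.
(* Parts are positive, so the recursion misses [p.1 = mone]. The full convolution is used and this
   term, equal to [logder r m], is taken out again. The boundary term with [N] cancels the full
   convolution, leaving [logder r m]. *)
transitivity (\sum_(p <- factor m) ((p.2 == mone)%:R * (N%:R * (powsqf r p.1)%:R) -
   ((powsqf r p.1)%:R * logder r p.2 -
     (p.1 == mone)%:R * ((powsqf r p.1)%:R * logder r p.2)))); last first.
  rewrite !sumrB big_factor_snd1 big_factor_fst1 sum_factor_logder //=.
  rewrite (_ : powsqf r mone = true) ?/powsqf ?mdom1 // -/(powsqf r m).
  case: (boolP (powsqf r m)) => [sm|_]; last by rewrite /=; ring.
  suff -> : (\sum_(v <- finsupp m) v.1)%N = N by rewrite /=; ring.
  by apply/eqP; rewrite -(eqn_pmul2l r0) -mN -mon_deg_powsqf.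
apply: eq_big_seq => p; rewrite in_factor => /eqP pm.
case: (boolP (powsqf r p.1)) => sp /=; last first.
  by rewrite big1 => [|d _]; rewrite ?mul0r ?mulr0 ?subr0.
(* The degree of [p.1] is [r * e], so [e] is the only part [d] that can contribute; for [e = 0]
   there is none and [p.1] is 1. *)
have := mon_deg_powsqf _ _ sp; set e := (X in (r * X)%N) => p1.
have degp : (mon_deg p.1 + mon_deg p.2)%N = (r * N)%N by rewrite -mN -pm mon_degM.
have eN : (e <= N)%N by rewrite -(leq_pmul2l r0) -p1 -degp leq_addr.
have degp2 : mon_deg p.2 = (r * (N - e))%N by rewrite mulnBr -degp -p1 addKn.
have [e0|e0] := posnP e.
  rewrite big1 => [|d _]; last first.
    by rewrite p1 e0 eqn_pmul2l // eq_sym eqn0Ngt posnat_gt0 /= mul0r.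
  move: (p1); rewrite e0 muln0 => /eqP; rewrite mon_deg_eq0 => ->.
  by rewrite -mon_deg_eq0 degp2 e0 muln_eq0 eqn0Ngt r0 /=; ring.
rewrite (bigD1_seq (PosNat e0)) ?mem_parts_upto ?uniq_parts_upto //= p1 eqxx.
rewrite big1 => [|d dNe]; last first.
  rewrite eqn_pmul2l // (_ : e == d = false) ?mul0r //; apply: contraNF dNe.
  by move=> /eqP ed; apply/eqP/val_inj.
rewrite -!mon_deg_eq0 degp2 p1 !muln_eq0 !(eqn0Ngt r) r0 eqxx (eqn0Ngt e) e0 /=.
have [Ne|_] := eqVneq (N - e)%N 0%N; last by rewrite /=; ring.
have -> : e = N by lia.
by rewrite /=; ring.
Qed.

(** * The dyadic sum and the coefficients of the power sum *)

(** For odd [n] only [a = 0] occurs, with sign +. For even [n] the term [a = 0] is -1 and the others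
    form twice the sum for n/2, so the total is -1 + 2 = 1. *)
Lemma sum_dyadic K n : (0 < n < 2 ^ K)%N ->
  \sum_(0 <= a < K | (2 ^ a %| n)%N) (2 ^ a)%:R * (-1) ^+ (n %/ 2 ^ a).-1 = 1 :> rat.
Proof.
elim: K n => [|K IHK] n /andP [n0 nK]; first by move: nK; rewrite expn0; lia.
rewrite big_mkcond big_ltn // big_add1 /= dvd1n expn0 divn1 mul1r.
have [nodd|neven] := boolP (odd n).
  rewrite big1_seq => [|a _]; last first.
    rewrite ifF //; apply: contraTF nodd => /(dvdn_trans (dvdn_exp2l 2 (ltn0Sn a))).
    by rewrite expn1 dvdn2.
  by case: n n0 nodd {nK} => //= n _ nodd; rewrite -signr_odd (negPf nodd) addr0.
pose k := n./2; have nk : n = (2 * k)%N by rewrite mul2n even_halfK.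
have k0 : (0 < k < 2 ^ K)%N.
  move: n0 nK; rewrite nk muln_gt0 /= => ->.
  by rewrite expnS ltn_pmul2l.
have -> : (-1) ^+ n.-1 = -1 :> rat.
  by case: n n0 neven {nK k nk k0} => //= n _; rewrite negbK -signr_odd => ->.
rewrite (_ : \sum_(0 <= a < K) _ = 2%:R *
    \sum_(0 <= a < K | (2 ^ a %| k)%N) (2 ^ a)%:R * (-1) ^+ (k %/ 2 ^ a).-1).
  by rewrite IHK //; ring.
rewrite big_distrr [RHS]big_mkcond; apply: eq_bigr => a _ /=.
by rewrite nk expnS dvdn_pmul2l // divnMl // natrM mulrA.
Qed.

Lemma finsupp_varX v n : (0 < n)%N -> finsupp (varX v n) = [fset v]%fset :> {fset var}.
Proof. by move=> n0; rewrite finsupp_expcmn // mdomU. Qed.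

Lemma mon_deg_varX v n : mon_deg (varX v n) = (v.1 * n)%N.
Proof.
case: n => [|n]; first by rewrite muln0 /varX /mon_deg mdom1 big_seq_fset0.
by rewrite /mon_deg finsupp_varX // big_seq_fset1 varXv.
Qed.

(** A power of x_(k,j) of degree [d] automatically has exponent d/k, so the divisibility condition
    is absorbed into the degree. As [d] is positive, the support of such a power is a singleton,
    which determines (k,j). *)
Lemma PserE d m : (0 < d)%N -> Pser d m =
  if mon_deg m == d
  then \sum_(v <- finsupp m) (m == varX v (m v))%:R * v.1%:R else 0.
Proof.
move=> d0; rewrite /Pser /fps_sum /fps_scale /fps_mon.
have key (k j : posnat) : (k %| d)%N -> m = varX (k, j) (d %/ k) ->
    [/\ (k, j) \in finsupp m, m = varX (k, j) (m (k, j)) & mon_deg m = d].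
  move=> kd mE; have dk0 : (0 < d %/ k)%N by rewrite divn_gt0 ?posnat_gt0 // dvdn_leq.
  rewrite {4}mE mon_deg_varX mulnC divnK //.
  by rewrite mE finsupp_varX // in_fset1 eqxx varXv.
case: (pselect (exists2 v, v \in finsupp m & m = varX v (m v) /\ mon_deg m = d)).
  case=> -[k j] vm [mv md]; rewrite md eqxx.
  have mv0 : (0 < m (k, j))%N by rewrite lt0n cmE_neq0.
  have dE : d = (k * m (k, j))%N by rewrite -md {1}mv mon_deg_varX.
  have uniq (k' j' : posnat) : (k' %| d)%N -> m = varX (k', j') (d %/ k') -> (k', j') = (k, j).
    by move=> k'd /key => /(_ k'd) [+ _ _]; rewrite mv finsupp_varX // in_fset1 => /eqP.
  have -> : finsupp m = [fset (k, j)]%fset :> {fset var} by rewrite mv finsupp_varX.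
  have kd : (k %| d)%N by rewrite dE dvdn_mulr.
  rewrite big_seq_fset1 -mv eqxx mul1r (fsum_single _ _ k) ?mem_set //; last first.
    move=> k' k'd k'k; rewrite fsbig1 // => j' _.
    case: eqP => [/uniq|_]; last by rewrite /= mulr0.
    by move=> /(_ k'd) [k'E]; rewrite k'E eqxx in k'k.
  rewrite (fsum_single _ _ j) ?in_setT; last first.
    move=> j' _ j'j; case: eqP => [/uniq|_]; last by rewrite /= mulr0.
    by move=> /(_ kd) [j'E]; rewrite j'E eqxx in j'j.
  by rewrite dE mulKn ?posnat_gt0 // -/(varX _ _) -mv eqxx mulr1.
move=> Nv; transitivity (0 : rat).
  apply: fsbig1 => k kd; apply: fsbig1 => j _; case: eqP => [|_]; last by rewrite /= mulr0.
  by move=> /(key _ _ kd) [vm mv md]; case: Nv; exists (k, j).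
case: eqP => // md; rewrite big1_seq // => v /= vm; case: eqP => [mv|_]; last by rewrite /= mul0r.
by case: Nv; exists v.
Qed.

Definition pow2 (a : nat) : posnat := PosNat (expn_gt0 2 a : (0 < 2 ^ a)%N).

(** After exchanging the sums, only a pure power x_v^e contributes. There d = [v.1] e, so 2^a
    dividing e already divides [d], and [sum_dyadic] applies to e because e <= d < 2^(d+1). *)
Lemma sum_pow2_logder d m : (0 < d)%N -> mon_deg m = d ->
  \sum_(0 <= a < d.+1 | (2 ^ a %| d)%N) (2 ^ a)%:R * logder (2 ^ a) m =
  \sum_(v <- finsupp m) (m == varX v (m v))%:R * v.1%:R.
Proof.
move=> d0 md.
transitivity (\sum_(0 <= a < d.+1 | (2 ^ a %| d)%N)
    \sum_(v <- finsupp m) (2 ^ a)%:R * logder_var (2 ^ a) v m).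
  by apply: eq_bigr => a _; rewrite big_distrr.
rewrite exchange_big; apply: eq_big_seq => v vm /=.
have mv0 : (0 < m v)%N by rewrite lt0n cmE_neq0.
rewrite /logder_var mv0; case: (eqVneq m (varX v (m v))) => [mv|_] /=; last first.
  by rewrite mul0r big1 // => a _; rewrite mulr0.
have dE : d = (v.1 * m v)%N by rewrite -md {1}mv mon_deg_varX.
transitivity ((\sum_(0 <= a < d.+1 | (2 ^ a %| m v)%N)
    (2 ^ a)%:R * (-1) ^+ (m v %/ 2 ^ a).-1) * v.1%:R : rat); last first.
  congr (_ * _); apply: sum_dyadic; rewrite mv0 /=.
  apply: leq_ltn_trans (ltn_expl _ _) => //.
  by rewrite (leq_trans _ (leqnSn d)) // dE leq_pmull ?posnat_gt0.
rewrite big_distrl /= big_mkcond [RHS]big_mkcond; apply: eq_bigr => a _.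
case: (boolP (2 ^ a %| m v)%N) => [am|_]; last by rewrite mulr0 if_same.
by rewrite dE dvdn_mull // mulrA.
Qed.

(** * Singular dyadic polycompositions and the final summation *)

Definition dyad_polycomp (x : nat * composition) : polycomp :=
  [fsfun [fsfun] with pow2 x.1 |-> x.2].

Lemma dyad_polycompE a c r : dyad_polycomp (a, c) r = if r == pow2 a then c else [::].
Proof. by rewrite fsfun_withE /=; case: ifP => // _; rewrite fsfunE. Qed.

Lemma finsupp_dyad_polycomp a c : c != [::] -> finsupp (dyad_polycomp (a, c)) = [fset pow2 a]%fset.
Proof.
move=> c0; apply/fsetP => r; rewrite in_fset1 mem_finsupp dyad_polycompE.
by case: ifP => //; rewrite eqxx.
Qed.

(** Positivity of [d] excludes the empty composition, whose polycomposition would have empty support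
    and forget the exponent [a]. Otherwise the support recovers [a], and the value there recovers
    the composition. *)
Lemma dyad_polycomp_bij d : (0 < d)%N ->
  set_bij [set x : nat * composition | (2 ^ x.1 * comp_size x.2)%N = d] (PCom_dyad d) dyad_polycomp.
Proof.
move=> d0.
have c0 (a : nat) (c : composition) : (2 ^ a * comp_size c)%N = d -> c != [::].
  by move=> cd; apply: contraL d0 => /eqP c0; rewrite -cd c0 /comp_size big_nil muln0.
split=> [[a c] /= cd|[a c] [a' c'] /set_mem /= cd /set_mem /= cd'|delta].
- have c1 := c0 _ _ cd; split; last by exists (pow2 a), a; rewrite finsupp_dyad_polycomp.
  by rewrite /PCom /= /polycomp_size finsupp_dyad_polycomp // big_seq_fset1 dyad_polycompE eqxx.
- move=> E; have := finsupp_dyad_polycomp a' c' (c0 _ _ cd').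
  rewrite -E finsupp_dyad_polycomp ?(c0 _ _ cd) // => /fset1_inj /(congr1 posnat_val) /= /eqP.
  rewrite eqn_exp2l // => /eqP aa; move: E; rewrite -aa.
  move=> /(congr1 (fun f : polycomp => f (pow2 a))).
  by rewrite !dyad_polycompE eqxx => ->.
case; rewrite /PCom /= /polycomp_size => dd [r [a [rs ra]]].
move: dd; rewrite rs big_seq_fset1 ra => dd; exists (a, delta r) => //=.
have rE : r = pow2 a by apply: val_inj.
apply/fsfunP => s; rewrite dyad_polycompE -rE; case: eqVneq => [->//|sr].
by apply/esym/eqP; rewrite -memNfinsupp rs in_fset1.
Qed.

Lemma fps_scaleE c f m : fps_scale c f m = c * f m.
Proof. by []. Qed.

Theorem proposition31 (d : nat) (hd : (1 <= d)%N) :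
  Pser d = fps_sum (PCom_dyad d) (fun delta =>
          fps_scale ((-1) ^+ (polycomp_length delta - 1) * (polycomp_L delta)%:R)
                    (Eplus_polycomp delta)).
Proof.
apply: functional_extensionality_dep => m; rewrite PserE // /fps_sum.
rewrite (reindex_fsbig _ _ _ _ (dyad_polycomp_bij _ hd)).
(* A finite list of all the pairs: a < 2^a <= d bounds the exponent, and [c] runs over the
   compositions of d / 2^a. *)
pose s := [seq (a, c) | a <- [seq a <- iota 0 d.+1 | (2 ^ a %| d)%N], c <- comps d (d %/ 2 ^ a)].
rewrite (fsbig_fwiden s); first last.
- move=> x [/= /allpairsPdep [a [c [+ + ->]]]]; rewrite mem_filter => /andP [ad _].
  by rewrite mem_comps ?leq_div // => /eqP cd []; rewrite /= cd mulnC divnK.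
- apply: allpairs_uniq_dep => [|a _|]; rewrite ?filter_uniq ?iota_uniq ?uniq_comps //.
  by move=> [a1 c1] [a2 c2] _ _ /= [-> ->].
- move=> [a c] /= cd; apply/allpairsPdep; exists a, c; split=> //.
    rewrite mem_filter mem_iota /= ltnS -{1}cd dvdn_mulr //.
    apply: leq_trans (ltnW (ltn_expl a (ltnSn 1))) _.
    by rewrite -[d in (_ <= d)%N]cd leq_pmulr //; move: hd; rewrite -cd muln_gt0 => /andP [].
  by rewrite mem_comps ?leq_div // -cd mulKn ?expn_gt0.
rewrite big_allpairs_dep big_filter -[iota 0 d.+1]/(index_iota 0 d.+1).
transitivity (\sum_(0 <= a < d.+1 | (2 ^ a %| d)%N)
    (2 ^ a)%:R * comp_sum (pow2 a) d (d %/ 2 ^ a) m).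
  (* Since 2^a divides [d], the degree condition in [comp_sumE] becomes [mon_deg m == d] for every
     [a]. *)
  under [RHS]eq_bigr => a ad do rewrite comp_sumE ?leq_div //= mulnC divnK //.
  case: eqP => [md|_]; first by rewrite sum_pow2_logder.
  by rewrite big1 // => a _; rewrite mulr0.
apply: eq_bigr => a ad; rewrite /comp_sum big_distrr; apply: eq_big_seq => c.
rewrite mem_comps ?leq_div // => /eqP cd.
have c0 : c != [::].
  apply: contraTneq hd => c0; move: cd; rewrite c0 /comp_size big_nil => /esym /eqP.
  by rewrite -leqn0 -ltnS => ?; rewrite -(divnK ad); lia.
rewrite fps_scaleE /polycomp_length /polycomp_L /Eplus_polycomp /blocks.
rewrite finsupp_dyad_polycomp // !big_seq_fset1 (_ : enum_fset _ = [:: pow2 a]); last first.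
  by apply/perm_small_eq=> //; apply: uniq_perm; rewrite ?fset_uniq // => x; rewrite in_fset1 inE.
rewrite /= cats0 big_map dyad_polycompE eqxx.
by rewrite natrM /comp_weight mulrA; congr (_ * _); ring.
Qed.
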